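(* Consider the linear regression model $\boldsymbol{Y}=\boldsymbol{X}\boldsymbol{\beta}+\boldsymbol{\varepsilon}$, where $\boldsymbol{X}$ is a known $n\times p$ matrix with linearly independent columns ($n>p$) and $\boldsymbol{\varepsilon}\sim N(\boldsymbol{0},\sigma^2\boldsymbol{I}_n)$, $\sigma^2>0$ unknown. Let $\theta=\boldsymbol{a}^T\boldsymbol{\beta}$ ($\boldsymbol{a}\neq\boldsymbol{0}$ given), $\boldsymbol{\tau}=\boldsymbol{C}^T\boldsymbol{\beta}-\boldsymbol{t}$ with $\boldsymbol{C}$ a given $p\times s$ matrix ($s<p$) of linearly independent columns, $\boldsymbol{t}$ a given $s$-vector, and $\boldsymbol{a}$ not in the column span of $\boldsymbol{C}$. Let $\hat{\boldsymbol{\beta}}$ be the least squares estimator, $\hat\Sigma^2=\|\boldsymbol{Y}-\boldsymbol{X}\hat{\boldsymbol{\beta}}\|^2/(n-p)$, $\hat\Theta=\boldsymbol{a}^T\hat{\boldsymbol{\beta}}$, $\hat{\boldsymbol{\tau}}=\boldsymbol{C}^T\hat{\boldsymbol{\beta}}-\boldsymbol{t}$, and assume $E\big((\hat{\boldsymbol{\tau}}-\boldsymbol{\tau})(\hat\Theta-\theta)\big)=\boldsymbol{0}$. Let $v_{11}=\boldsymbol{a}^T(\boldsymbol{X}^T\boldsymbol{X})^{-1}\boldsymbol{a}$, $\boldsymbol{V}_{22}=\boldsymbol{C}^T(\boldsymbol{X}^T\boldsymbol{X})^{-1}\boldsymbol{C}$, $F=\big(\hat{\boldsymbol{\tau}}^T\boldsymbol{V}_{22}^{-1}\hat{\boldsymbol{\tau}}/s\big)/\hat\Sigma^2$,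 and for a function $d:[0,\infty)\to(0,\infty)$ let $J(d)=[\hat\Theta-\sqrt{v_{11}}\hat\Sigma d(\sqrt F),\ \hat\Theta+\sqrt{v_{11}}\hat\Sigma d(\sqrt F)]$. Suppose $d_1,d_2:[0,\infty)\to(0,\infty)$ satisfy $d_1(x)\ge d_2(x)$ for all $x\ge0$, and that there exist $\epsilon>0$ and an interval $[a,b]$ with $0\le a<b$ such that $d_1(x)>d_2(x)+\epsilon$ for all $x\in[a,b]$. Then $P(\theta\in J(d_1))>P(\theta\in J(d_2))$ for all values of $\|\boldsymbol{\gamma}\|$, where $\boldsymbol{\gamma}=(1/\sigma)\boldsymbol{V}_{22}^{-1/2}\boldsymbol{\tau}$.
   Context: $\|\boldsymbol{\gamma}\|=\sqrt{\boldsymbol{\gamma}^T\boldsymbol{\gamma}}$; the claim holds for all parameter values $(\boldsymbol{\beta},\sigma^2)$. *)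

(* Defs.v *)
From HB Require Import structures.
From mathcomp Require Import all_boot all_order all_algebra.
From mathcomp Require Import all_classical all_reals all_analysis.
Set Implicit Arguments. Unset Strict Implicit. Unset Printing Implicit Defensive.
Import Order.TTheory GRing.Theory Num.Theory.
Local Open Scope classical_set_scope.
Local Open Scope ring_scope.

Section regression.
Variable R : realType.

Definition sc (M : 'M[R]_1) : R := M ord0 ord0.

Definition sqnorm m (v : 'cV[R]_m) : R := sc (v^T *m v).

Definition ols n p (X : 'M[R]_(n, p)) (Y : 'cV[R]_n) : 'cV[R]_p :=
  invmx (X^T *m X) *m X^T *m Y.

Definition sigma2hat n p (X : 'M[R]_(n, p)) (Y : 'cV[R]_n) : R :=
  sqnorm (Y - X *m ols X Y) / (n - p)%:R.

Definition thetahat n p (X : 'M[R]_(n, p)) (a : 'cV[R]_p) (Y : 'cV[R]_n) : R :=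
  sc (a^T *m ols X Y).

Definition tauhat n p s (X : 'M[R]_(n, p)) (C : 'M[R]_(p, s)) (t : 'cV[R]_s)
  (Y : 'cV[R]_n) : 'cV[R]_s := C^T *m ols X Y - t.

Definition v11 n p (X : 'M[R]_(n, p)) (a : 'cV[R]_p) : R :=
  sc (a^T *m invmx (X^T *m X) *m a).

Definition V22 n p s (X : 'M[R]_(n, p)) (C : 'M[R]_(p, s)) : 'M[R]_s :=
  C^T *m invmx (X^T *m X) *m C.

Definition Fstat n p s (X : 'M[R]_(n, p)) (C : 'M[R]_(p, s)) (t : 'cV[R]_s)
  (Y : 'cV[R]_n) : R :=
  (sc ((tauhat X C t Y)^T *m invmx (V22 X C) *m tauhat X C t Y) / s%:R)
  / sigma2hat X Y.

Definition inJ n p s (X : 'M[R]_(n, p)) (a : 'cV[R]_p) (C : 'M[R]_(p, s))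
  (t : 'cV[R]_s) (d : R -> R) (theta : R) (Y : 'cV[R]_n) : Prop :=
  let half := Num.sqrt (v11 X a) * Num.sqrt (sigma2hat X Y)
              * d (Num.sqrt (Fstat X C t Y)) in
  thetahat X a Y - half <= theta <= thetahat X a Y + half.

End regression.

(* Mutual independence of a finite family of real random variables:
   the joint law of (eps_i)_i is the product of the marginals on
   measurable rectangles (taking B i = setT recovers every subfamily). *)
Definition mutually_independent {R : realType} (dT : measure_display)
  (T : measurableType dT) (P : probability T R) (n : nat)
  (eps : 'I_n -> T -> R) : Prop :=
  forall B : 'I_n -> set R, (forall i, measurable (B i)) ->
    P (\bigcap_(i in [set: 'I_n]) (eps i @^-1` B i))
    = (\prod_(i < n) P (eps i @^-1` B i))%E.

(* Main.v *)
(* Write Y = X beta + e. The least squares estimators are affine in e, and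
   along a direction v = X b with a^T b = 0 and C^T b <> 0 the quantities
   thetahat and sigma2hat stay constant while tauhat moves linearly, so that
   sqrt F restricted to the line e + R v is the square root of a quadratic
   polynomial. Countably many rational levels q cover the gap between d2 and
   d1, so for some q and del > 0 the set A where d2 <= q < q + del <= d1 has
   positive Lebesgue measure. The event
     D = { sqrt F in A, q < |thetahat - theta| / (sqrt v11 Sigmahat) < q + del }
   separates the two coverage events, and it remains to see P(D) > 0. If P(D) = 0,
   then P(e + x v in D) = 0 for every real x, as the law of e is quasi-invariant
   under translations, so by Fubini almost every line e + R v meets D in a null set.
   But for all e in a nonempty open set, the line meets D in the preimage of A
   under a locally Lipschitz function whose range covers A, and such a preimage
   is not null. *)
Require Import Defs.
From HB Require Import structures.
From mathcomp Require Import all_boot all_order all_algebra.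
From mathcomp Require Import all_classical all_reals all_analysis.
From mathcomp Require Import measurable_realfun.
From mathcomp Require Import ring lra.
Import Order.TTheory GRing.Theory Num.Theory.
Import numFieldNormedType.Exports.
Local Open Scope classical_set_scope.
Local Open Scope ring_scope.

(** * Null sets on the real line *)

(* [f] need only be Lipschitz on [N]: each piece of a cover of [N] meets [N] in
   a set whose image has diameter at most [L] times the length of the piece. *)
Lemma lipschitz_null_image (R : realType) (f : R -> R) (L : R) (N : set R) :
  0 <= L -> lebesgue_measure N = 0%E ->
  (forall x y, N x -> N y -> `|f x - f y| <= L * `|x - y|) ->
  lebesgue_measure (f @` N) = 0%E.
Proof.
move=> L0 N0 fL; apply/eqP; rewrite eq_le measure_ge0 andbT.
apply/lee_addgt0Pr => e e0; rewrite add0e.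
(* A piece of length [b - a] has its image within [(L + 1) * (b - a)] of one value, hence the factor
   2. Taking [L + 1] instead of [L] keeps [K] positive, so that [e / K] makes sense. *)
have [K K0 KE] : exists2 K, 0 < K & K = 2 * (L + 1).
  by exists (2 * (L + 1)); lra.
have /ereal_inf_lt[_ [/= M [mM NM] <-] Me] : (lebesgue_measure N < (e / K)%:E)%E.
  by rewrite N0 lte_fin divr_gt0.
have cov k : exists c : R * R, (c.1 <= c.2) /\ (c.2 - c.1)%:E = (K%:E * wlength idfun (M k))%E
    /\ f @` (N `&` M k) `<=` `[c.1, c.2].
  have /ocitvP[->|[[a b] /= ab ->]] := mM k.
    exists (0, 0); split => //; split; first by rewrite wlength0 mule0 subrr.
    by move=> _ [x [_ []]].
  have [[y [Ny /= yab]]|none] := pselect (exists y, N y /\ `]a, b]%classic y).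
    exists (f y - (L + 1) * (b - a), f y + (L + 1) * (b - a)) => /=; split; last split.
    - have : 0 <= (L + 1) * (b - a) by rewrite mulr_ge0; lra.
      lra.
    - rewrite wlength_itv/= lte_fin ab -EFinB -EFinM; congr (_%:E); rewrite KE; ring.
    - move=> _ [x [Nx xab] <-] /=; rewrite in_itv/=.
      have := fL _ _ Nx Ny; rewrite in_itv/= in yab; rewrite /= in_itv/= in xab.
      have h : `|x - y| <= b - a.
        by rewrite ler_norml; move/andP : xab => []; move/andP : yab => []; lra.
      have : L * `|x - y| <= (L + 1) * (b - a).
        by apply: ler_pM => //; lra.
      move=> h1 h2; have := le_trans h2 h1; rewrite ler_norml; lra.
  (* The piece misses [N], so its image is empty and any interval of the prescribed length
     serves. *)
  exists (0, K * (b - a)) => /=; split; last split.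
  - by rewrite mulr_ge0; lra.
  - by rewrite wlength_itv/= lte_fin ab -EFinB -EFinM subr0.
  - by move=> _ [x [Nx xab] <-]; exfalso; apply: none; exists x.
have [c hc] := choice cov.
apply: (@le_trans _ _ (\sum_(k <oo) lebesgue_measure (`[(c k).1, (c k).2]%classic : set R))%E).
  apply: (le_trans _ (outer_measure_sigma_subadditive lebesgue_measure _)).
  apply: le_outer_measure => _ [x Nx <-].
  have [k _ Mkx] := NM _ Nx; exists k => //.
  by apply: (hc k).2.2; exists x.
apply: (@le_trans _ _ (\sum_(k <oo) (K%:E * wlength idfun (M k)))%E).
  apply: lee_nneseries => [//|k _].
    rewrite lebesgue_measure_itv/= lte_fin.
    have [c1 [c2 _]] := hc k; rewrite -c2; case: ifPn => // _.
    by rewrite lee_fin subr_ge0.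
rewrite nneseriesZl; last by move=> k _; exact: wlength_ge0.
have -> : e = K * (e / K) by rewrite mulrC divfK// lt0r_neq0.
rewrite EFinM. by apply: (lee_wpmul2l _ (ltW Me)); rewrite lee_fin ltW.
Qed.

(** The density is positive everywhere, so its integral over [A] vanishes only if [A] is
    Lebesgue-null. *)
Lemma normal_prob_eq0 (R : realType) (m sigma : R) (A : set R) :
  sigma != 0 -> measurable A ->
  (normal_prob m sigma A = 0)%E -> lebesgue_measure A = 0%E.
Proof.
move=> s0 mA A0.
have pdf_gt0 x : 0 < normal_pdf m sigma x.
  by rewrite normal_pdfE// mulr_gt0 ?expR_gt0// normal_peak_gt0.
have mf : measurable_fun A (fun x => (normal_pdf m sigma x)%:E).
  by apply/measurable_funTS/measurable_EFinP; exact: measurable_normal_pdf.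
have := (ae_eq_integral_abs lebesgue_measure mA mf).1.
case.
  rewrite -[RHS]A0; apply: eq_integral => x _.
  by rewrite gee0_abs// lee_fin ltW.
move=> B [mB B0 AB]; apply/eqP; rewrite eq_le measure_ge0 andbT -B0.
apply: le_outer_measure => x Ax; apply: AB => /= /(_ Ax) [] x0.
by move: (pdf_gt0 x); rewrite x0 ltxx.
Qed.

(** * The law of the error vector *)

Definition rect {R : realType} {n : nat} (B : 'I_n -> set R) : set 'cV[R]_n :=
  [set e | forall i, B i (e i ord0)].

Definition rects (R : realType) (n : nat) : set (set 'cV[R]_n) :=
  [set rect B | B in [set B : 'I_n -> set R | forall i, measurable (B i)]].

(* Column vectors carry no measurable structure in the library; this is the
   product sigma-algebra. *)
Definition Rvec (R : realType) (n : nat) := g_sigma_algebraType (rects R n).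

HB.instance Definition _ (R : realType) (n : nat) :=
  Measurable.on (Rvec R n).
HB.instance Definition _ (R : realType) (n : nat) :=
  GRing.Lmodule.copy (Rvec R n) 'cV[R]_n.

Lemma measurable_rect (R : realType) n (B : 'I_n -> set R) :
  (forall i, measurable (B i)) -> measurable (rect B : set (Rvec R n)).
Proof. by move=> mB; apply: sub_sigma_algebra; exists B. Qed.

Lemma rectsI (R : realType) n : setI_closed (rects R n).
Proof.
move=> _ _ [A mA <-] [B mB <-]; exists (fun i => A i `&` B i) => [i|].
  exact: measurableI.
apply/seteqP; split => e /=; rewrite /rect/=; last by move=> [eA eB] i; split.
by move=> eAB; split => i; have [] := eAB i.
Qed.

Lemma rectsT (R : realType) n : rects R n setT.
Proof. by exists (fun=> setT) => [i|]; [exact: measurableT|apply/seteqP; split]. Qed.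

Lemma measurable_coord (R : realType) n (i : 'I_n) :
  measurable_fun [set: Rvec R n] (fun e : 'cV[R]_n => e i ord0).
Proof.
move=> _ B mB; rewrite setTI; apply: sub_sigma_algebra.
exists (fun j => if j == i then B else setT) => [j|] /=.
  by case: ifP => // _; exact: measurableT.
apply/seteqP; split => e /=; rewrite /rect/=.
  by move=> /(_ i); rewrite eqxx.
by move=> Be j; case: eqP => // ->.
Qed.

(** Rectangles generate the sigma-algebra, and the preimage of one is a finite intersection of
    coordinate preimages. *)
Lemma measurable_vec (R : realType) n d (T : measurableType d) (f : T -> Rvec R n) :
  (forall i, measurable_fun [set: T] (fun x => (f x : 'cV[R]_n) i ord0)) ->
  measurable_fun [set: T] f.
Proof.
move=> mf.
apply: (measurability _ (erefl : @measurable _ (Rvec R n) = <<s rects R n >>)).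
move=> _ [_ [B mB <-] <-].
rewrite setTI (_ : _ @^-1` _ =
    \bigcap_(i in [set: 'I_n]) ((fun x => (f x : 'cV[R]_n) i ord0) @^-1` B i)).
  apply: fin_bigcap_measurable => // i _; rewrite -[X in measurable X]setTI.
  exact: mf.
by apply/seteqP; split => x /= xB i; [move=> _|]; exact: xB.
Qed.

Lemma measurable_shift (R : realType) n (v : 'cV[R]_n) (D : set (Rvec R n)) :
  measurable D -> measurable [set e : Rvec R n | D (e + v)].
Proof.
move=> mD; rewrite -[X in measurable X]setTI.
suff : measurable_fun setT (fun e : Rvec R n => (e : 'cV[R]_n) + v : Rvec R n) by apply.
apply: measurable_vec => j.
apply: (eq_measurable_fun (fun e : Rvec R n => (e : 'cV[R]_n) j ord0 + v j ord0)) => [x _|].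
  by rewrite !mxE.
by apply: measurable_funD => //; exact: measurable_coord.
Qed.

Lemma integral_eq0_ae {d} {T : measurableType d} {R : realType}
  (mu : {measure set T -> \bar R}) (f : T -> \bar R) :
  measurable_fun [set: T] f -> (forall x, 0 <= f x)%E ->
  (\int[mu]_x f x = 0)%E <-> mu.-negligible [set x | f x != 0%E].
Proof.
move=> mf f0.
have := ae_eq_integral_abs mu measurableT mf.
rewrite (eq_integral f) => [->|x _]; last by rewrite gee0_abs.
split=> -[A [mA A0 fA]]; exists A; split => // x /= fx; apply: fA => /=.
  by move=> /(_ I) /eqP; rewrite (negPf fx).
by apply/eqP => fx0; apply: fx.
Qed.

(** The product measure integrates the measures of the sections, so it vanishes exactly when almost
    every section is null. *)
Lemma product_measure1_null {d1 d2} {T1 : measurableType d1} {T2 : measurableType d2}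
  {R : realType} (m1 : {sigma_finite_measure set T1 -> \bar R})
  (m2 : {sigma_finite_measure set T2 -> \bar R}) (X Y : set (T1 * T2)) :
  measurable X -> measurable Y ->
  (forall y, m2 (xsection X y) = 0%E -> m2 (xsection Y y) = 0%E) ->
  ((m1 \x m2) X = 0)%E -> ((m1 \x m2) Y = 0)%E.
Proof.
move=> mX mY XY; rewrite /product_measure1.
move=> /(integral_eq0_ae _ _ (measurable_fun_xsection m2 mX) (fun=> measure_ge0 _ _)) X0.
apply/(integral_eq0_ae _ _ (measurable_fun_xsection m2 mY) (fun=> measure_ge0 _ _)).
by apply: negligibleS X0 => y /=; apply: contra_neq => /XY.
Qed.

(** The normal law and Lebesgue measure have the same null sets, and a translation, being
    1-Lipschitz, preserves the latter. *)
Lemma normal_prob_null_shift (R : realType) (m sigma c : R) (A : set R) :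
  sigma != 0 -> measurable A -> normal_prob m sigma A = 0%E ->
  normal_prob m sigma [set x | A (x + c)] = 0%E.
Proof.
move=> s0 mA A0.
have mA' : measurable [set x | A (x + c)].
  rewrite -[X in measurable X]setTI.
  by apply: (measurable_funD (@measurable_id _ _ _) (measurable_cst c)).
have dom := normal_prob_dominates m sigma.
have := (null_content_dominatesP _ _).1 dom _ mA'; apply.
have -> : [set x | A (x + c)] = (fun x => x - c) @` A.
  apply/seteqP; split => [x /= Axc|_ [x Ax <-] /=]; last by rewrite subrK.
  by exists (x + c) => //; rewrite addrK.
apply: (@lipschitz_null_image _ _ 1) => //; first exact: normal_prob_eq0 A0.
by move=> x y _ _; rewrite mul1r opprB addrA subrK.
Qed.

Section iid_normal.
Context {R : realType} {n : nat} {sigma : R} {dT : measure_display}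
  {T : measurableType dT} {P : probability T R} {eps : 'I_n -> {RV P >-> R}}.
Hypothesis sigma0 : sigma != 0.
Hypothesis indep : mutually_independent P (fun i => eps i : T -> R).
Hypothesis law : forall i (A : set R), measurable A ->
  distribution P (eps i) A = normal_prob 0 sigma A.

Definition vec (w : T) : Rvec R n := \col_i eps i w.

Lemma measurable_vec_eps : measurable_fun [set: T] vec.
Proof.
apply: measurable_vec => i; apply: (eq_measurable_fun (eps i)) => [x _|].
  by rewrite mxE.
exact: measurable_funPT.
Qed.

Lemma prob_rect (B : 'I_n -> set R) : (forall i, measurable (B i)) ->
  P (vec @^-1` rect B) = (\prod_(i < n) normal_prob 0 sigma (B i))%E.
Proof.
move=> mB; rewrite -(eq_bigr _ (fun i _ => law i _ (mB i))) -indep//.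
congr (P _); apply/seteqP; split => w /=; rewrite /rect/= => wB i.
  by have := wB i; rewrite mxE.
by rewrite mxE; exact: wB.
Qed.

(** Coordinate [i] is set to 0 rather than deleted: the dimension stays [n], and adding [eps i w]
    times the [i]-th unit vector gives [vec w] back. *)
Definition vec_off (i : 'I_n) (w : T) : Rvec R n :=
  \col_j (if j == i then 0 else eps j w).

Lemma measurable_vec_off i : measurable_fun [set: T] (vec_off i).
Proof.
apply: measurable_vec => j.
case: (eqVneq j i) => [->|ji].
  apply: (eq_measurable_fun (cst 0 : T -> R)) => [x _|]; last exact: measurable_cst.
  by rewrite mxE eqxx.
apply: (eq_measurable_fun (eps j)) => [x _|].
  by rewrite mxE (negPf ji).
exact: measurable_funPT.
Qed.

Let off i : {mfun T >-> Rvec R n} := mfun_Sub (mem_set (measurable_vec_off i)).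

(* A rectangle condition on [vec_off i] constrains only the errors other than
   [eps i], apart from the fixed value 0 in coordinate [i]. *)
Lemma prob_off_rect i (A : set R) (B : set (Rvec R n)) :
  measurable A -> rects R n B ->
  (P ((off i @^-1` B) `&` (eps i @^-1` A)) = normal_prob 0 sigma A * P (off i @^-1` B))%E.
Proof.
move=> mA [C mC <-].
have [C0|C0] := pselect (C i 0); last first.
  have -> : off i @^-1` rect C = set0.
    by apply/seteqP; split => w //= /(_ i); rewrite mxE eqxx.
  by rewrite set0I measure0 mule0.
(* Side [i] of the rectangle is free: [A' = A] gives the joint event, [A' = setT] the event on the
   other errors alone. *)
pose C' A' j := if j == i then A' else C j.
have mC' A' : measurable A' -> forall j, measurable (C' A' j).
  by move=> mA' j; rewrite /C'; case: ifP.
have eqC' A' : (off i @^-1` rect C) `&` (eps i @^-1` A') = vec @^-1` rect (C' A').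
  apply/seteqP; split => w /=; rewrite /rect /C'/=.
    by move=> [offC Aw] j; rewrite mxE; have := offC j; rewrite mxE; case: eqP => // ->.
  move=> h; split; last by have := h i; rewrite mxE eqxx.
  by move=> j; have := h j; rewrite !mxE; case: eqP => // ->.
have prodC' A' : measurable A' -> P (vec @^-1` rect (C' A')) =
    (normal_prob 0 sigma A' * \prod_(j < n | j != i) normal_prob 0 sigma (C j))%E.
  move=> mA'; rewrite prob_rect; last exact: mC'.
  rewrite (bigD1 i)//= /C' eqxx; congr (_ * _)%E.
  by apply: eq_bigr => j /negPf ->.
rewrite eqC' prodC'//; congr (_ * _)%E.
have -> : off i @^-1` rect C = vec @^-1` rect (C' setT) by rewrite -eqC' setIT.
rewrite prodC'//.
by rewrite probability_setT mul1e.
Qed.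

(** Both sides are finite measures in [B]. They agree on rectangles, which are stable under
    intersection and generate the sigma-algebra. *)
Lemma prob_off i (A : set R) (B : set (Rvec R n)) :
  measurable A -> measurable B ->
  (P ((off i @^-1` B) `&` (eps i @^-1` A)) = normal_prob 0 sigma A * P (off i @^-1` B))%E.
Proof.
move=> mA mB.
have mepsA : measurable (eps i @^-1` A) by exact: measurable_funPTI.
have N0 : 0 <= fine (normal_prob 0 sigma A) by rewrite fine_ge0.
have [mu1 mu1E] : exists mu : {measure set (Rvec R n) -> \bar R},
    forall B, mu B = P ((off i @^-1` B) `&` (eps i @^-1` A)).
  by exists (pushforward (mrestr P mepsA) (off i)).
have [mu2 mu2E] : exists mu : {measure set (Rvec R n) -> \bar R},
    forall B, mu B = (normal_prob 0 sigma A * P (off i @^-1` B))%E.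
  exists (mscale (NngNum N0) (distribution P (off i))) => C.
  by rewrite -[in RHS](@fineK _ (normal_prob 0 sigma A))// fin_num_measure.
rewrite -mu1E -mu2E.
apply: (@measure_unique _ _ (Rvec R n) (rects R n) (fun=> setT) erefl) => //.
- exact: rectsI.
- by move=> _; exact: rectsT.
- by rewrite bigcup_const//; exists 0%N.
- by move=> C CR; rewrite mu1E mu2E prob_off_rect.
- move=> _; rewrite mu1E; apply: le_lt_trans (probability_le1 _ _) (ltry _).
  by apply: measurableI => //; exact: measurable_funPTI.
Unshelve. exact: measurable_vec_off.
Qed.

Let measurable_eps i : @measurable_fun _ _ T (measurableTypeR R) [set: T] (eps i).
Proof.
move=> _ A mA; have mA' : @measurable _ R A by exact: mA.
by rewrite setTI; exact: (measurable_funPTI (eps i) mA').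
Qed.

(** Factorisation on measurable rectangles determines the joint law, by uniqueness of the product
    measure. *)
Lemma prob_off_joint i (X : set (Rvec R n * measurableTypeR R)) : measurable X ->
  P [set w | X (vec_off i w, eps i w)] =
  (distribution P (off i) \x normal_prob 0 sigma)%E X.
Proof.
move=> mX.
pose pr (w : T) : Rvec R n * measurableTypeR R := (vec_off i w, eps i w).
have mpr : measurable_fun [set: T] pr.
  by apply: measurable_fun_pair; [exact: measurable_vec_off|exact: measurable_eps].
have [mu muE] : exists mu : {measure set (Rvec R n * measurableTypeR R) -> \bar R},
    forall B, mu B = P [set w | B (vec_off i w, eps i w)].
  by unshelve eexists (pushforward P pr).
rewrite -muE; apply/esym/product_measure_unique => // B A mB mA.
by rewrite muE/= muleC -prob_off.
Qed.

(** With the other errors fixed, the shift translates a one-dimensional section of [D], and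
    translations preserve normal-null sets. *)
Lemma vec_null_shift_coord i (c : R) (D : set (Rvec R n)) : measurable D ->
  P (vec @^-1` D) = 0%E -> P [set w | D (vec w + c *: delta_mx i ord0)] = 0%E.
Proof.
move=> mD.
have mX c' : measurable [set yz : Rvec R n * measurableTypeR R |
    D (yz.1 + (yz.2 + c') *: delta_mx i ord0)].
  rewrite -[X in measurable X]setTI.
  suff : measurable_fun setT (fun yz : Rvec R n * measurableTypeR R =>
      (yz.1 : 'cV[R]_n) + (yz.2 + c') *: delta_mx i ord0 : Rvec R n) by apply.
  apply: measurable_vec => j.
  apply: (eq_measurable_fun (fun yz : Rvec R n * measurableTypeR R =>
      (yz.1 : 'cV[R]_n) j ord0 + (yz.2 + c') * (delta_mx i ord0 : 'cV[R]_n) j ord0)) => [x _|].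
    by rewrite !mxE.
  apply: measurable_funD; first exact: (measurableT_comp (measurable_coord _ _ _)).
  by apply: measurable_funM => //; apply: measurable_funD.
have E c' : [set w | D (vec w + c' *: delta_mx i ord0)] =
    [set w | D (vec_off i w + (eps i w + c') *: delta_mx i ord0)].
  apply/seteqP; split => w /=; congr D; apply/matrixP => j k;
    rewrite !mxE (ord1 k) eqxx andbT; case: (eqVneq j i) => [->|_] /=; ring.
(* A shift by 0 puts both events in the same form, with 0 and [c] as values of one parameter. *)
have -> : vec @^-1` D = [set w | D (vec w + 0 *: delta_mx i ord0)].
  by apply/seteqP; split => w /=; rewrite scale0r addr0.
rewrite !E (prob_off_joint _ _ (mX 0)) (prob_off_joint _ _ (mX c)).
apply: product_measure1_null => // y.
have xX c' : xsection [set yz : Rvec R n * measurableTypeR R |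
    D (yz.1 + (yz.2 + c') *: delta_mx i ord0)] y =
    [set x | D (y + (x + c') *: delta_mx i ord0)].
  by apply/seteqP; split => x; rewrite /xsection/= inE.
have := measurable_xsection y (mX 0); rewrite !xX => mA.
move=> /(normal_prob_null_shift _ _ _ c _ sigma0 mA) /=.
by under eq_set do rewrite addr0.
Qed.

(** The translation is performed one coordinate at a time, each step being absorbed into the set. *)
Lemma vec_null_shift (v : 'cV[R]_n) (D : set (Rvec R n)) : measurable D ->
  P (vec @^-1` D) = 0%E -> P [set w | D (vec w + v)] = 0%E.
Proof.
move=> mD D0.
rewrite [v]matrix_sum_delta; under eq_bigr do rewrite big_ord1.
elim: (index_enum _) D mD D0 => [|i r IH] D mD D0.
  by rewrite big_nil; under eq_set do rewrite addr0.
rewrite big_cons.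
pose D' : set (Rvec R n) := [set e | D (e + v i ord0 *: delta_mx i ord0)].
have := IH D' (measurable_shift _ _ _ _ mD) (vec_null_shift_coord _ _ _ mD D0).
by rewrite /D'/=; under eq_set do rewrite -addrA [X in _ + X]addrC.
Qed.

(* If [D] were null, then so would be all its translates, and by Fubini almost
   every line in direction [v] would meet [D] in a null set. *)
Lemma prob_vec_gt0 (v : 'cV[R]_n) (D E : set (Rvec R n)) :
  measurable D -> measurable E ->
  (forall e, E e -> lebesgue_measure [set x | D (e + x *: v)] <> 0%E) ->
  (0 < P (vec @^-1` E) -> 0 < P (vec @^-1` D))%E.
Proof.
move=> mD mE ED PE; rewrite lt0e measure_ge0 andbT; apply/eqP => D0.
pose X : set (T * measurableTypeR R) := [set wx | D (vec wx.1 + wx.2 *: v)].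
have mX : measurable X.
  rewrite -[X in measurable X]setTI.
  suff : measurable_fun setT (fun wx : T * measurableTypeR R =>
      (vec wx.1 : 'cV[R]_n) + wx.2 *: v : Rvec R n) by apply.
  apply: measurable_vec => j.
  apply: (eq_measurable_fun (fun wx : T * measurableTypeR R =>
      eps j wx.1 + wx.2 * v j ord0)) => [x _|].
    by rewrite !mxE.
  apply: measurable_funD; last exact: measurable_funM.
  exact: (measurableT_comp (measurable_eps j)).
have X0 : ((P \x lebesgue_measure) X = 0)%E.
  (* The order of integration is exchanged: for fixed [x] the section is the event that a translate
     of [D] occurs, which is null. *)
  rewrite (@product_measure_unique _ _ _ _ _ P lebesgue_measure (P \x^ lebesgue_measure)%E)//.
    apply: integral0_eq => x _ /=.
    have -> : ysection X x = [set w | D (vec w + x *: v)].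
      by apply/seteqP; split => w; rewrite /ysection/= inE.
    exact: vec_null_shift.
  by move=> A B mA mB; exact: product_measure2E.
have mPE : measurable (vec @^-1` E).
  by rewrite -[X in measurable X]setTI; exact: measurable_vec_eps.
have /(integral_eq0_ae _ _ (measurable_fun_xsection _ mX) (fun=> measure_ge0 _ _)) := X0.
move=> [A [mA A0 XA]]; suff : (P (vec @^-1` E) <= P A)%E by rewrite A0 leNgt PE.
apply: le_measure; rewrite ?inE// => w /= /ED h; apply: XA => /=; apply/eqP.
suff -> : xsection X w = [set x | D (vec w + x *: v)] by [].
by apply/seteqP; split => x; rewrite /xsection/= inE.
Qed.

(** The neighbourhood contains a box of intervals of positive length, whose probability is a product
    of positive normal probabilities. *)
Lemma prob_vec_nbhs (e0 : 'cV[R]_n) (E : set (Rvec R n)) :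
  measurable E -> nbhs e0 E -> (0 < P (vec @^-1` E))%E.
Proof.
move=> mE [Q Qe0 QE].
have ballQ i : exists r : {posnum R}, ball (e0 i ord0) r%:num `<=` Q i ord0.
  by have /nbhs_ballP[r /= r0 rQ] := Qe0 i ord0; exists (PosNum r0).
have [r rQ] := choice ballQ.
pose B i : set R := ball (e0 i ord0) (r i)%:num.
have mB i : measurable (B i) by exact: measurable_ball.
apply: (@lt_le_trans _ _ (P (vec @^-1` rect B))).
  rewrite prob_rect//; apply: (big_ind (fun x => 0 < x)%E) => [|x y|i _].
  - exact: lte01.
  - exact: mule_gt0.
  rewrite lt0e measure_ge0 andbT; apply/eqP => /(normal_prob_eq0 _ _ _ _ sigma0 (mB i)).
  rewrite lebesgue_measure_ball// => /eqP.
  by rewrite eqe; apply/negP; rewrite gt_eqF// pmulrn_lgt0.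
apply: le_measure; rewrite ?inE.
- rewrite -[X in measurable X]setTI; apply: measurable_vec_eps => //.
  exact: measurable_rect.
- by rewrite -[X in measurable X]setTI; exact: measurable_vec_eps.
- by move=> w /= wB; apply: QE => i j; rewrite (ord1 j); apply: rQ; exact: wB.
Qed.

End iid_normal.

(** * Gap level and quadratic preimages *)

(** The function starts at or below [l] and reaches [m] by some [M], so its values on [[0, M]] cover
    [A]. Where its value is at least [l > 0] it is Lipschitz, so a null preimage would make [A]
    null. *)
Lemma sqrt_quadratic_preimage (R : realType) (A : set R) (l m al be ga : R) :
  0 < l -> A `<=` `[l, m] -> lebesgue_measure A <> 0%E ->
  0 < al -> ga <= l ^+ 2 ->
  lebesgue_measure [set x | A (Num.sqrt (al * x ^+ 2 + be * x + ga))] <> 0%E.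
Proof.
move=> l0 Alm A0 al0 gal pre0; apply: A0.
pose q x := al * x ^+ 2 + be * x + ga; pose f x := Num.sqrt (q x).
(* At [M] the quadratic exceeds [m ^ 2], because [al * M + be >= 1]. *)
pose M := (`|be| + 1) / al + (m ^+ 2 + `|ga|).
have M1 : m ^+ 2 + `|ga| <= M by rewrite lerDr divr_ge0 ?addr_ge0// ltW.
have M2 : `|be| + 1 <= al * M.
  rewrite /M mulrDr mulrC divfK ?gt_eqF// lerDl mulr_ge0 ?addr_ge0 ?sqr_ge0//.
  exact: ltW.
have M0 : 0 <= M by apply: le_trans M1; rewrite addr_ge0 ?sqr_ge0.
have qM : m ^+ 2 <= q M.
  have h : M <= M * (al * M + be).
    rewrite ler_peMr//; have := ler_norm (- be); rewrite normrN; lra.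
  have := ler_norm (- ga); rewrite normrN /q; nra.
pose N := `[0, M] `&` [set x | A (f x)].
have N0 : lebesgue_measure N = 0%E.
  apply/eqP; rewrite eq_le measure_ge0 andbT -pre0.
  by apply: le_outer_measure => x [].
have fl x : N x -> l <= f x by move=> [_ /Alm]; rewrite /= in_itv/= => /andP[].
have q0 x : N x -> 0 <= q x.
  by move=> /fl lf; apply/ltW; rewrite -sqrtr_gt0; exact: lt_le_trans lf.
apply/eqP; rewrite eq_le measure_ge0 andbT.
rewrite -(lipschitz_null_image _ f ((2 * al * M + `|be|) / l) _ _ N0).
- apply: le_outer_measure => y Ay.
  have := Alm _ Ay; rewrite /= in_itv/= => /andP[ly ym].
  have cf : {within `[0, M], continuous f}.
    apply: continuous_subspaceT => x.
    apply: (continuous_comp (f := q)); last exact: sqrt_continuous.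
    apply: continuousD; last exact: cvg_cst.
    apply: continuousD; apply: continuousM; try exact: cvg_cst; try exact: cvg_id.
    exact: exprn_continuous.
  have f0 : f 0 <= l.
    rewrite /f /q mulr0 expr0n/= mulr0 !add0r -(ger0_norm (ltW l0)) -sqrtr_sqr.
    exact: ler_wsqrtr.
  have fM : m <= f M.
    apply: le_trans (ler_norm _) _; rewrite -sqrtr_sqr; exact: ler_wsqrtr.
  have fM0 : f 0 <= f M by lra.
  have [|x xM fxy] := IVT M0 cf (v := y).
    by rewrite min_l// max_r//; apply/andP; split; lra.
  by exists x => //; split => //=; rewrite fxy.
- by rewrite divr_ge0 ?addr_ge0 ?mulr_ge0// ltW.
move=> x y Nx Ny.
have [fx fy] := (fl _ Nx, fl _ Ny).
(* Since [f x + f y >= l], dividing this difference of squares gives the Lipschitz constant. *)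
have E : (f x - f y) * (f x + f y) = (x - y) * (al * (x + y) + be).
  have -> : (f x - f y) * (f x + f y) = f x ^+ 2 - f y ^+ 2 by ring.
  by rewrite !sqr_sqrtr ?q0// /q; ring.
rewrite mulrAC ler_pdivlMr//.
apply: (@le_trans _ _ (`|f x - f y| * (f x + f y))).
  by apply: ler_wpM2l => //; lra.
rewrite -[X in _ * X]ger0_norm; last by lra.
rewrite -normrM E normrM mulrC ler_wpM2r//.
have [[+ _] [+ _]] := (Nx, Ny); rewrite /= !in_itv/= => /andP[x0 xM] /andP[y0 yM].
apply: le_trans (ler_normD _ _) _; rewrite lerD2r ger0_norm ?mulr_ge0//; [nra|lra|lra].
Qed.

(* The levels are taken rational so that countably many of them suffice. *)
Lemma gap_level (R : realType) (d1 d2 : R -> R) (eps0 lo hi : R) :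
  measurable_fun (`[0, +oo[ : set R) d1 -> measurable_fun (`[0, +oo[ : set R) d2 ->
  (forall x, 0 <= x -> 0 < d2 x) ->
  0 < eps0 -> 0 <= lo -> lo < hi ->
  (forall x, lo <= x <= hi -> d2 x + eps0 < d1 x) ->
  exists (l q del : R) (A : set R),
    [/\ [/\ 0 < l, 0 < q & 0 < del], measurable A, A `<=` `[l, hi],
      lebesgue_measure A <> 0%E & forall x, A x -> d2 x <= q /\ q + del <= d1 x].
Proof.
move=> md1 md2 d2_0 e0 lo0 lohi gap.
(* The midpoint is used because [lo] may be 0, while the levels must stay away from 0. *)
pose l := (lo + hi) / 2.
pose A (r : rat) : set R := `[l, hi] `&`
  ((`[0, +oo[ `&` d2 @^-1` `]-oo, ratr r]) `&`
   (`[0, +oo[ `&` d1 @^-1` `[ratr r + eps0 / 2, +oo[)).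
have l0 : 0 < l by rewrite /l; lra.
have mA r : measurable (A r).
  apply: measurableI => //; apply: measurableI.
    exact: md2. exact: md1.
have [r Ar0] : exists r, lebesgue_measure (A r) <> 0%E.
  apply: contrapT => /forallNP A0.
  have {}A0 r : lebesgue_measure (A r) = 0%E by apply: contrapT; exact: A0.
  pose F n := if unpickle n is Some r then A r else set0.
  have F0 : (lebesgue_measure (\bigcup_n F n) = 0)%E.
    apply/eqP; rewrite eq_le measure_ge0 andbT.
    apply: (le_trans (outer_measure_sigma_subadditive lebesgue_measure _)).
    rewrite eseries0// => n _ _; rewrite /F.
    by case: unpickle => [r|]; [exact: A0|exact: measure0].
  (* Each [x] lies in [A s] for a rational [s] between [d2 x] and [d2 x + eps0 / 2], so an interval
     of positive length would be null. *)
  have : (lebesgue_measure (`[l, hi] : set R) <= lebesgue_measure (\bigcup_n F n))%E.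
    apply: le_outer_measure => x; rewrite /= in_itv/= => /andP[lx xhi].
    have x0 : 0 <= x by lra.
    have gx : d2 x + eps0 < d1 x by apply: gap; rewrite xhi andbT; rewrite /l in lx; lra.
    have [s] := @rat_in_itvoo _ (d2 x) (d2 x + eps0 / 2) ltac:(lra).
    rewrite in_itv/= => /andP[s1 s2].
    exists (pickle s); [by []|]; rewrite /F pickleK; split; first by rewrite /= in_itv/= lx.
    by rewrite /= !in_itv/= !andbT x0; split; split => //; lra.
  rewrite F0 lebesgue_measure_itv/= lte_fin ifT; last by rewrite /l; lra.
  by rewrite -EFinB lee_fin /l; lra.
(* Any point of [A r] shows that the level is positive, as [0 < d2 x <= ratr r]. *)
have [x Arx] : A r !=set0 by apply/set0P/eqP => A0; apply: Ar0; rewrite A0 measure0.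
exists l, (ratr r), (eps0 / 2), (A r); split => //.
- split => //; last by lra.
  case: Arx => _ [[/= + +] _]; rewrite !in_itv/= andbT => /d2_0; exact: lt_le_trans.
- by move=> y [].
- by move=> y [_ [[_ +] [_ +]]]; rewrite /= !in_itv/= andbT.
Qed.

(** * Regular functions and positive definite matrices *)

Section regular_functions.
Context {R : realType} {n : nat}.
Implicit Types f g : 'cV[R]_n -> R.

(** Measurability, for the product sigma-algebra, turns inequalities into events; continuity, for
    the matrix topology, turns strict ones into neighbourhoods. *)
Definition regular f :=
  measurable_fun [set: Rvec R n] (f : Rvec R n -> R) /\ continuous f.

Lemma regular_cst c : regular (fun=> c).
Proof. by split; [exact: measurable_cst|exact: cst_continuous]. Qed.

Lemma regular_coord i : regular (fun e => e i ord0).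
Proof. by split; [exact: measurable_coord|exact: coord_continuous]. Qed.

Lemma regularD f g : regular f -> regular g -> regular (fun e => f e + g e).
Proof.
move=> [mf cf] [mg cg]; split; first exact: measurable_funD.
by move=> x; exact: (cvgD (cf x) (cg x)).
Qed.

Lemma regularM f g : regular f -> regular g -> regular (fun e => f e * g e).
Proof.
move=> [mf cf] [mg cg]; split; first exact: measurable_funM.
by move=> x; exact: (cvgM (cf x) (cg x)).
Qed.

Lemma regular_sum (I : Type) (r : seq I) (F : I -> 'cV[R]_n -> R) :
  (forall i, regular (F i)) -> regular (fun e => \sum_(i <- r) F i e).
Proof.
move=> rF; elim: r => [|i r IH].
  by under eq_fun do rewrite big_nil; exact: regular_cst.
by under eq_fun do rewrite big_cons; exact: regularD.
Qed.

Lemma regular_comp (h : R -> R) f :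
  measurable_fun [set: R] h -> continuous h -> regular f -> regular (h \o f).
Proof.
move=> mh ch [mf cf]; split; first exact: measurableT_comp.
by move=> x; apply: continuous_comp; [exact: cf|exact: ch].
Qed.

Lemma regular_norm f : regular f -> regular (fun e => `|f e|).
Proof. by apply: (regular_comp Num.norm); [|exact: norm_continuous]. Qed.

Lemma regular_sqrt f : regular f -> regular (fun e => Num.sqrt (f e)).
Proof.
apply: (regular_comp Num.sqrt); last exact: sqrt_continuous.
by apply: continuous_measurable_fun; exact: sqrt_continuous.
Qed.

Definition mxregular m p (F : 'cV[R]_n -> 'M[R]_(m, p)) :=
  forall i j, regular (fun e => F e i j).

Lemma mxregular_id : mxregular _ _ id.
Proof. by move=> i j; rewrite (ord1 j); exact: regular_coord. Qed.

Lemma mxregular_cst m p (M : 'M[R]_(m, p)) : mxregular _ _ (fun=> M).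
Proof. by move=> i j; exact: regular_cst. Qed.

Lemma mxregularD m p (F G : 'cV[R]_n -> 'M[R]_(m, p)) :
  mxregular _ _ F -> mxregular _ _ G -> mxregular _ _ (fun e => F e + G e).
Proof. by move=> rF rG i j; under eq_fun do rewrite mxE; exact: regularD. Qed.

Lemma mxregularM m p q (F : 'cV[R]_n -> 'M[R]_(m, p)) (G : 'cV[R]_n -> 'M[R]_(p, q)) :
  mxregular _ _ F -> mxregular _ _ G -> mxregular _ _ (fun e => F e *m G e).
Proof.
move=> rF rG i j; under eq_fun do rewrite mxE.
by apply: regular_sum => k; exact: regularM.
Qed.

Lemma mxregular_tr m p (F : 'cV[R]_n -> 'M[R]_(m, p)) :
  mxregular _ _ F -> mxregular _ _ (fun e => (F e)^T).
Proof. by move=> rF i j; under eq_fun do rewrite mxE; exact: rF. Qed.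

Lemma regular_measurable_lt f g : regular f -> regular g ->
  measurable [set e : Rvec R n | f e < g e].
Proof.
move=> [mf _] [mg _]; rewrite -[X in measurable X]setTI.
have := measurable_fun_ltr mf mg measurableT (Y := [set true]) I.
by rewrite setTI; congr measurable; apply/seteqP; split => e.
Qed.

Lemma regular_nbhs_lt f g e0 : regular f -> regular g -> f e0 < g e0 ->
  nbhs e0 [set e | f e < g e].
Proof.
move=> [_ cf] [_ cg] fg.
have h : (fun e => g e - f e) @ e0 --> g e0 - f e0.
  exact: (cvgB (cg e0) (cf e0)).
have := cvgr_gt _ h 0; rewrite subr_gt0 => /(_ _ fg).
by apply: filterS => e /=; rewrite subr_gt0.
Qed.

End regular_functions.

Section positive_definite.
Context {R : realType}.

Definition posdef m (A : 'M[R]_m) :=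
  forall v : 'cV[R]_m, v != 0 -> 0 < sc (v^T *m A *m v).

Lemma sqnormE m (v : 'cV[R]_m) : sqnorm v = \sum_i v i ord0 ^+ 2.
Proof. by rewrite /sqnorm /sc mxE; apply: eq_bigr => i _; rewrite mxE expr2. Qed.

Lemma sqnorm_ge0 m (v : 'cV[R]_m) : 0 <= sqnorm v.
Proof. by rewrite sqnormE sumr_ge0// => i _; exact: sqr_ge0. Qed.

Lemma sqnorm_gt0 m (v : 'cV[R]_m) : v != 0 -> 0 < sqnorm v.
Proof.
move=> v0; rewrite lt_def sqnorm_ge0 andbT; apply: contraNneq v0.
rewrite sqnormE => /eqP; rewrite psumr_eq0 => [/allP vi0|i _]; last exact: sqr_ge0.
apply/eqP/matrixP => i j; rewrite mxE (ord1 j); apply/eqP.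
by rewrite -sqrf_eq0; apply: (vi0 i); rewrite mem_index_enum.
Qed.

Lemma posdef_unit m (A : 'M[R]_m) : posdef _ A -> A \in unitmx.
Proof.
move=> pA; rewrite -row_free_unit; apply: inj_row_free => v vA.
apply/eqP; apply: contraPT (lexx 0 : is_true ((0 : R) <= 0)) => v0.
have vT0 : v^T != 0 by rewrite -trmx0 (inj_eq trmx_inj).
by have := pA _ vT0; rewrite trmxK vA mul0mx /sc mxE ltxx.
Qed.

(** The form of the inverse at [v] is the form of [A] at [invmx A *m v]. *)
Lemma posdef_inv m (A : 'M[R]_m) : A^T = A -> posdef _ A -> posdef _ (invmx A).
Proof.
move=> sA pA v v0; have uA := posdef_unit _ _ pA.
have -> : v^T *m invmx A *m v = (invmx A *m v)^T *m A *m (invmx A *m v).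
  by rewrite trmx_mul trmx_inv sA mulmxKV// mulmxA.
apply: pA; apply: contra_neq v0 => iv0.
by rewrite -[v](mulKVmx uA) iv0 mulmx0.
Qed.

Lemma posdef_conj m k (A : 'M[R]_m) (C : 'M[R]_(m, k)) :
  posdef _ A -> \rank C = k -> posdef _ (C^T *m A *m C).
Proof.
move=> pA rC v v0.
have -> : v^T *m (C^T *m A *m C) *m v = (C *m v)^T *m A *m (C *m v).
  by rewrite trmx_mul !mulmxA.
apply: pA; apply: contra_neq v0 => Cv0.
have fC : row_free C^T by rewrite /row_free mxrank_tr rC.
have : v^T *m C^T = 0 by rewrite -trmx_mul Cv0 trmx0.
by move=> /eqP; rewrite mulmx_free_eq0// -trmx0 (inj_eq trmx_inj) => /eqP.
Qed.

Lemma quad_addZ m (A : 'M[R]_m) (h w : 'cV[R]_m) (x : R) :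
  sc ((h + x *: w)^T *m A *m (h + x *: w)) =
  sc (w^T *m A *m w) * x ^+ 2 + (sc (h^T *m A *m w) + sc (w^T *m A *m h)) * x
  + sc (h^T *m A *m h).
Proof.
have -> : (h + x *: w)^T = h^T + x *: w^T by rewrite linearD linearZ.
rewrite !mulmxDl !mulmxDr -!scalemxAl -!scalemxAr /sc !mxE.
ring.
Qed.

End positive_definite.

(** Stacking [a^T] on [C^T] gives independent rows, hence a right inverse. This is what lets
    [thetahat] and [tauhat] be moved independently. *)
Lemma exists_preimage_pair (R : fieldType) (p s : nat) (a : 'cV[R]_p) (C : 'M[R]_(p, s))
  (al : R) (y : 'cV[R]_s) : \rank C = s -> ~~ (a^T <= C^T)%MS ->
  exists b : 'cV[R]_p, a^T *m b = al%:M /\ C^T *m b = y.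
Proof.
move=> rC aC.
have free : row_free (col_mx a^T C^T).
  apply: inj_row_free => v; rewrite -[v]hsubmxK mul_row_col [lsubmx v]mx11_scalar.
  set c := lsubmx v 0 0; set d := rsubmx v; rewrite mul_scalar_mx => cd.
  have c0 : c = 0.
    apply: contraNeq aC => c0.
    have -> : a^T = (- c^-1 *: d) *m C^T.
      have dC : d *m C^T = - (c *: a^T) by apply/eqP; rewrite -addr_eq0 addrC cd.
      rewrite -scalemxAl dC.
      by rewrite scalerN scaleNr opprK scalerA mulVf// scale1r.
    exact: submxMl.
  move: cd; rewrite c0 scale0r add0r => /eqP; rewrite mulmx_free_eq0 => [/eqP ->|].
    by rewrite raddf0 row_mx0.
  by rewrite /row_free mxrank_tr rC.
exists (pinvmx (col_mx a^T C^T) *m col_mx al%:M y).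
by apply: eq_col_mx; rewrite -mul_col_mx mulmxA mulmxVp// mul1mx.
Qed.

(** * Coverage probabilities in the regression model *)

(** Inversion is continuous off 0, and the single point 0 is treated apart. *)
Lemma measurable_invr (R : realType) : measurable_fun [set: R] (@GRing.inv R).
Proof.
have -> : [set: R] = [set 0] `|` ~` [set 0] by rewrite setUv.
have m0 : measurable ([set 0] : set R) by exact: measurable_set1.
apply/measurable_funU => //; first exact: measurableC.
split; first exact: measurable_fun_set1.
apply: open_continuous_measurable_fun.
  by rewrite openC; exact: closed_eq.
by move=> x; rewrite inE /= => /eqP; exact: inv_continuous.
Qed.

(** * Positive definiteness of the Gram matrices, and the estimators under translation by [X b] *)

Section regression_geometry.
Context {R : realType} {n p s : nat} (X : 'M[R]_(n, p)) (a : 'cV[R]_p)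
  (C : 'M[R]_(p, s)) (t : 'cV[R]_s).
Hypotheses (pn : (p < n)%N) (rX : \rank X = p).

Lemma posdef1 m : posdef m (1%:M : 'M[R]_m).
Proof. by move=> v v0; rewrite mulmx1; exact: sqnorm_gt0. Qed.

Lemma posdef_gram : posdef p (X^T *m X).
Proof. by rewrite -(mulmx1 X^T); apply: posdef_conj => //; exact: posdef1. Qed.

Lemma gram_tr : (X^T *m X)^T = X^T *m X.
Proof. by rewrite trmx_mul trmxK. Qed.

Lemma posdef_gram_inv : posdef p (invmx (X^T *m X)).
Proof. by apply: posdef_inv; [exact: gram_tr|exact: posdef_gram]. Qed.

Lemma posdef_V22_inv : \rank C = s -> posdef s (invmx (V22 X C)).
Proof.
move=> rC; apply: posdef_inv; last exact: posdef_conj posdef_gram_inv rC.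
by rewrite /V22 !trmx_mul trmxK trmx_inv gram_tr mulmxA.
Qed.

Lemma v11_gt0 : a != 0 -> 0 < v11 X a.
Proof. exact: posdef_gram_inv. Qed.

Lemma ols_mulX (b : 'cV[R]_p) : ols X (X *m b) = b.
Proof.
rewrite /ols mulmxA -(mulmxA (invmx _)) mulVmx ?mul1mx//.
exact: posdef_unit posdef_gram.
Qed.

Lemma ols_addX (y : 'cV[R]_n) (b : 'cV[R]_p) : ols X (y + X *m b) = ols X y + b.
Proof. by rewrite -[in RHS](ols_mulX b) /ols mulmxDr. Qed.

Lemma sigma2hat_addX y b : sigma2hat X (y + X *m b) = sigma2hat X y.
Proof.
by rewrite /sigma2hat ols_addX mulmxDr [X *m ols X y + _]addrC opprD addrA addrK.
Qed.

Lemma tauhat_addX y b : tauhat X C t (y + X *m b) = tauhat X C t y + C^T *m b.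
Proof. by rewrite /tauhat ols_addX mulmxDr addrAC. Qed.

Lemma thetahat_addX y b : thetahat X a (y + X *m b) = thetahat X a y + sc (a^T *m b).
Proof. by rewrite /thetahat ols_addX mulmxDr /sc mxE. Qed.

(** As [p < n], some nonzero vector is orthogonal to all columns of [X]. *)
Lemma exists_residual : exists r : 'cV[R]_n, ols X r = 0 /\ 0 < sigma2hat X r.
Proof.
have : kermx X != 0.
  by rewrite -mxrank_eq0 mxrank_ker rX subn_eq0 -ltnNge.
move=> /rowV0Pn[u /sub_kermxP uX u0].
have ou : ols X u^T = 0 by rewrite /ols -mulmxA -trmx_mul uX trmx0 mulmx0.
exists u^T; split => //.
rewrite /sigma2hat ou mulmx0 subr0 divr_gt0 ?ltr0n ?subn_gt0//.
by apply: sqnorm_gt0; rewrite -trmx0 (inj_eq trmx_inj).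
Qed.

End regression_geometry.

(** * Coverage events as sets of error vectors *)

Section coverage.
Context {R : realType} {n p s : nat} (X : 'M[R]_(n, p)) (a : 'cV[R]_p)
  (C : 'M[R]_(p, s)) (t : 'cV[R]_s) (beta : 'cV[R]_p).
Hypotheses (pn : (p < n)%N) (rX : \rank X = p) (a0 : a != 0) (s0 : (0 < s)%N)
  (rC : \rank C = s) (aC : ~~ (a^T <= C^T)%MS).

Let theta := sc (a^T *m beta).
Let Y (e : 'cV[R]_n) := X *m beta + e.
Let u e := `|thetahat X a (Y e) - theta|.
Let scale e := Num.sqrt (v11 X a) * Num.sqrt (sigma2hat X (Y e)).
Let quad e := let h := tauhat X C t (Y e) in sc (h^T *m invmx (V22 X C) *m h).
Let rootF e := Num.sqrt (Fstat X C t (Y e)).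

Lemma inJE d e : inJ X a C t d theta (Y e) <-> u e <= scale e * d (rootF e).
Proof.
by rewrite /inJ /u /= distrC ler_distl.
Qed.

Lemma mxregular_Y : mxregular _ _ Y.
Proof. by apply: mxregularD; [exact: mxregular_cst|exact: mxregular_id]. Qed.

Lemma mxregular_ols : mxregular _ _ (fun e => ols X (Y e)).
Proof. by apply: mxregularM; [exact: mxregular_cst|exact: mxregular_Y]. Qed.

Lemma mxregular_tauhat : mxregular _ _ (fun e => tauhat X C t (Y e)).
Proof.
apply: mxregularD; last exact: mxregular_cst.
by apply: mxregularM; [exact: mxregular_cst|exact: mxregular_ols].
Qed.

Lemma regular_u : regular u.
Proof.
apply: regular_norm; apply: regularD; last exact: regular_cst.
by apply: mxregularM; [exact: mxregular_cst|exact: mxregular_ols].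
Qed.

Lemma regular_sigma2hat : regular (fun e => sigma2hat X (Y e)).
Proof.
apply: regularM; last exact: regular_cst.
have rres : mxregular _ _ (fun e => Y e - X *m ols X (Y e)).
  apply: mxregularD; first exact: mxregular_Y.
  move=> i j; under eq_fun do rewrite mxE -mulN1r.
  apply: regularM; first exact: regular_cst.
  by apply: mxregularM; [exact: mxregular_cst|exact: mxregular_ols].
by apply: mxregularM => //; exact: mxregular_tr.
Qed.

Lemma regular_scale : regular scale.
Proof.
by apply: regularM; [exact: regular_cst|apply: regular_sqrt; exact: regular_sigma2hat].
Qed.

Lemma regular_quad : regular quad.
Proof.
apply: mxregularM mxregular_tauhat _ _; apply: mxregularM; last exact: mxregular_cst.
exact: mxregular_tr mxregular_tauhat.
Qed.

(** Only measurability is claimed: the division by [sigma2hat] may break continuity where it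
    vanishes. *)
Lemma measurable_rootF : measurable_fun [set: Rvec R n] (rootF : Rvec R n -> R).
Proof.
have mV : measurable_fun [set: Rvec R n] (fun e : Rvec R n => (sigma2hat X (Y e))^-1).
  exact: (measurableT_comp (measurable_invr R) regular_sigma2hat.1).
have mF : measurable_fun [set: Rvec R n] (fun e : Rvec R n => Fstat X C t (Y e)).
  apply: measurable_funM mV.
  by apply: measurable_funM; [exact: regular_quad.1|exact: measurable_cst].
have msqrt : measurable_fun [set: R] (@Num.sqrt R).
  by apply: continuous_measurable_fun; exact: sqrt_continuous.
exact: (measurableT_comp msqrt mF).
Qed.

Lemma measurable_inJ d : measurable_fun (`[0, +oo[ : set R) d ->
  measurable [set e : Rvec R n | inJ X a C t d theta (Y e)].
Proof.
move=> md.
have -> : [set e : Rvec R n | inJ X a C t d theta (Y e)] =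
    [set e | u e <= scale e * d (rootF e)].
  by apply/seteqP; split => e /=; rewrite inJE.
have mr : measurable_fun [set: Rvec R n] (d \o rootF).
  apply: (measurable_comp (F := `[0, +oo[ : set R)) => //; last exact: measurable_rootF.
  by move=> _ [e _ <-] /=; rewrite in_itv/= andbT sqrtr_ge0.
have := measurable_fun_ler regular_u.1 (measurable_funM regular_scale.1 mr)
  measurableT (Y := [set true]) I.
by rewrite setTI; congr measurable; apply/seteqP; split => e.
Qed.

(** The separating event [D], with the division by [scale] cleared. *)
Let gap_set (A : set R) (q del : R) : set (Rvec R n) :=
  [set e | A (rootF e) /\ (q * scale e < u e /\ u e < (q + del) * scale e)].

(* The bound on [quad] puts the value of [sqrt F] at the start of the line
   below [l], so that along the line it runs through all of [A]. *)
Let window (l q del : R) : set (Rvec R n) :=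
  [set e | quad e < s%:R * l ^+ 2 * sigma2hat X (Y e) /\
    (q * scale e < u e /\ u e < (q + del) * scale e)].

Let scale_ge0 e : 0 <= scale e.
Proof. by rewrite mulr_ge0 ?sqrtr_ge0. Qed.

Lemma measurable_gap_set A q del : measurable A -> measurable (gap_set A q del).
Proof.
move=> mA; apply: measurableI.
  by rewrite -[X in measurable X]setTI; exact: measurable_rootF.
by apply: measurableI; apply: regular_measurable_lt; try exact: regular_u;
  apply: regularM; try exact: regular_cst; exact: regular_scale.
Qed.

Lemma measurable_window l q del : measurable (window l q del).
Proof.
apply: measurableI.
  apply: regular_measurable_lt; first exact: regular_quad.
  by apply: regularM; [exact: regular_cst|exact: regular_sigma2hat].
by apply: measurableI; apply: regular_measurable_lt; try exact: regular_u;
  apply: regularM; try exact: regular_cst; exact: regular_scale.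
Qed.

Let v11_sqrt_gt0 : 0 < Num.sqrt (v11 X a).
Proof. by rewrite sqrtr_gt0 (v11_gt0 _ _ rX). Qed.

(** The conditions are strict inequalities between continuous functions, so one point satisfying
    them suffices. *)
Lemma window_nbhs l q del : 0 < l -> 0 < q -> 0 < del ->
  exists e0 : 'cV[R]_n, nbhs e0 (window l q del).
Proof.
move=> l0 q0 del0.
(* [r] is a pure residual and fixes the scale; adding [X b] makes [tauhat]
   vanish and puts [thetahat] in the middle of the window. *)
have [r [or r0]] := exists_residual X pn rX.
pose k := Num.sqrt (v11 X a) * Num.sqrt (sigma2hat X r).
have k0 : 0 < k by rewrite mulr_gt0// sqrtr_gt0.
have [b [ab Cb]] := exists_preimage_pair _ _ _ a C ((q + del / 2) * k)
  (- (C^T *m beta - t)) rC aC.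
exists (r + X *m b).
have YE : Y (r + X *m b) = r + X *m (beta + b).
  by rewrite /Y mulmxDr addrCA.
have rhoE : sigma2hat X (Y (r + X *m b)) = sigma2hat X r by rewrite YE sigma2hat_addX.
have scaleE : scale (r + X *m b) = k by rewrite /scale rhoE.
have uE : u (r + X *m b) = (q + del / 2) * k.
  rewrite /u YE thetahat_addX// /thetahat or mulmx0 mulmxDr ab /theta /sc !mxE eqxx mulr1n.
  rewrite add0r addrC addrK ger0_norm// mulr_ge0 ?(ltW k0)//; lra.
have tauE : tauhat X C t (Y (r + X *m b)) = 0.
  rewrite YE tauhat_addX// /tauhat or mulmx0 mulmxDr Cb; apply/matrixP => i j.
  by rewrite !mxE; ring.
have rk c : regular (fun e => c * scale e).
  by apply: regularM; [exact: regular_cst|exact: regular_scale].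
apply: filterI; [|apply: filterI].
- apply: regular_nbhs_lt; [exact: regular_quad| |].
    by apply: regularM; [exact: regular_cst|exact: regular_sigma2hat].
  rewrite /quad tauE mulmx0 /sc mxE rhoE; apply: mulr_gt0 => //.
  by apply: mulr_gt0; rewrite ?ltr0n ?exprn_gt0.
- apply: regular_nbhs_lt; [exact: rk|exact: regular_u|].
  by rewrite scaleE uE ltr_pM2r//; lra.
- apply: regular_nbhs_lt; [exact: regular_u|exact: rk|].
  by rewrite scaleE uE ltr_pM2r//; lra.
Qed.

(** Along [v = X b] with [a^T b = 0] and [C^T b = w] nonzero, [u] and [scale] stay fixed, so only
    the condition on [rootF], the root of a quadratic, depends on [x]. *)
Lemma gap_set_section : exists v : 'cV[R]_n, forall (l hi q del : R) (A : set R),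
  0 < l -> 0 < q -> A `<=` `[l, hi] -> lebesgue_measure A <> 0%E ->
  forall e, window l q del e ->
    lebesgue_measure [set x | gap_set A q del (e + x *: v)] <> 0%E.
Proof.
pose w : 'cV[R]_s := const_mx 1.
have w0 : w != 0.
  apply/eqP => /matrixP/(_ (Ordinal s0) ord0); rewrite !mxE.
  by move/eqP; rewrite oner_eq0.
have [b [ab Cb]] := exists_preimage_pair _ _ _ a C 0 w rC aC.
exists (X *m b) => l hi q del A l0 q0 Alh A0 e [Qe [qu uq]].
have YE x : Y (e + x *: (X *m b)) = Y e + X *m (x *: b).
  by rewrite /Y addrA scalemxAr.
have scaleE x : scale (e + x *: (X *m b)) = scale e by rewrite /scale YE sigma2hat_addX.
have uE x : u (e + x *: (X *m b)) = u e.
  by rewrite /u YE thetahat_addX// -scalemxAr ab /sc !mxE mul0rn mulr0 addr0.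
(* The two strict bounds on [u e] are incompatible with [scale e = 0]. *)
have scale0 : 0 < scale e.
  rewrite lt_def scale_ge0 andbT; apply/eqP => k0.
  by move: (lt_trans qu uq); rewrite k0 !mulr0 ltxx.
have rho0 : 0 < sigma2hat X (Y e).
  by move: scale0; rewrite /scale pmulr_rgt0// sqrtr_gt0.
have s0R : 0 < s%:R :> R by rewrite ltr0n.
set V := invmx (V22 X C); set h := tauhat X C t (Y e).
pose k := (s%:R * sigma2hat X (Y e))^-1.
have k0 : 0 < k by rewrite invr_gt0 mulr_gt0.
have kE : k = s%:R^-1 * (sigma2hat X (Y e))^-1 by rewrite /k invfM.
have -> : [set x | gap_set A q del (e + x *: (X *m b))] =
    [set x | A (Num.sqrt (k * sc (w^T *m V *m w) * x ^+ 2
      + k * (sc (h^T *m V *m w) + sc (w^T *m V *m h)) * x + k * quad e))].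
  have rootE x : rootF (e + x *: (X *m b)) = Num.sqrt (k * sc (w^T *m V *m w) * x ^+ 2
      + k * (sc (h^T *m V *m w) + sc (w^T *m V *m h)) * x + k * quad e).
    rewrite /rootF /Fstat YE sigma2hat_addX// tauhat_addX// -scalemxAr Cb.
    rewrite quad_addZ -/V -/h kE /quad -/V -/h; congr Num.sqrt; ring.
  by apply/seteqP; split => x /=; rewrite /gap_set/= rootE scaleE uE => // -[].
apply: (sqrt_quadratic_preimage _ _ l hi) => //.
  by rewrite mulr_gt0// (posdef_V22_inv _ _ rX rC).
(* The constant term [k * quad e] is at most [l ^+ 2] by the first condition of [window]. *)
rewrite mulrC ler_pdivrMr; last exact: mulr_gt0.
by rewrite mulrCA mulrA; exact: ltW.
Qed.

Section probability.
Context {sigma : R} {dT : measure_display} {T : measurableType dT}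
  {P : probability T R} {eps : 'I_n -> {RV P >-> R}}.
Hypothesis sigma0 : sigma != 0.
Hypothesis indep : mutually_independent P (fun i => eps i : T -> R).
Hypothesis law : forall i (A : set R), measurable A ->
  distribution P (eps i) A = normal_prob 0 sigma A.

(** On [gap_set] the bound [d2 <= q] rules out coverage by [d2], while [q + del <= d1] forces
    coverage by [d1]. So the [d1] event contains the [d2] event and, disjoint from it, a set of
    positive probability. *)
Lemma coverage_lt (d1 d2 : R -> R) (eps0 lo hi : R) :
  measurable_fun (`[0, +oo[ : set R) d1 -> measurable_fun (`[0, +oo[ : set R) d2 ->
  (forall x, 0 <= x -> 0 < d2 x) ->
  (forall x, 0 <= x -> d2 x <= d1 x) ->
  0 < eps0 -> 0 <= lo -> lo < hi ->
  (forall x, lo <= x <= hi -> d2 x + eps0 < d1 x) ->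
  (P [set w | inJ X a C t d2 theta (Y (\col_i eps i w))] <
   P [set w | inJ X a C t d1 theta (Y (\col_i eps i w))])%E.
Proof.
move=> md1 md2 d20 d21 e0 lo0 lohi gap.
have [l [q [del [A [[l0 q0 del0] mA Alh A0 Agap]]]]] :=
  gap_level _ _ _ _ _ _ md1 md2 d20 e0 lo0 lohi gap.
have [v vP] := gap_set_section.
have [x0 x0W] := window_nbhs _ _ _ l0 q0 del0.
pose vec_eps : T -> Rvec R n := vec (eps := eps).
have PD : (0 < P (vec_eps @^-1` gap_set A q del))%E.
  apply: (prob_vec_gt0 sigma0 indep law v _ (window l q del)).
  - exact: measurable_gap_set.
  - exact: measurable_window.
  - exact: (vP l hi q del A l0 q0 Alh A0).
  - exact: (prob_vec_nbhs sigma0 indep law x0 _ (measurable_window _ _ _)).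
pose J d : set (Rvec R n) := [set e | inJ X a C t d theta (Y e)].
have mpre (B : set (Rvec R n)) : measurable B -> measurable (vec_eps @^-1` B).
  by move=> mB; rewrite -[X in measurable X]setTI; exact: measurable_vec_eps.
change (P (vec_eps @^-1` J d2) < P (vec_eps @^-1` J d1))%E.
have mJ d : measurable_fun (`[0, +oo[ : set R) d -> measurable (vec_eps @^-1` J d).
  by move=> md; apply: mpre; exact: measurable_inJ.
have mD := mpre _ (measurable_gap_set _ q del mA).
apply: (@lt_le_trans _ _ (P (vec_eps @^-1` J d2 `|` vec_eps @^-1` gap_set A q del))).
  rewrite measureU//; [|exact: mJ|].
    by rewrite lteDl// fin_num_measure//; exact: mJ.
  apply/seteqP; split => w //= -[/inJE ule [/Agap[dq _] [qu _]]].
  have := lt_le_trans qu ule; rewrite mulrC ltNge => /negP; apply.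
  by apply: ler_wpM2l => //; exact: scale_ge0.
rewrite le_measure ?inE; [by []|by apply: measurableU => //; exact: mJ|exact: mJ|].
move=> w /= [/inJE ule|[/Agap[_ dq] [_ uq]]]; apply/inJE.
  apply: le_trans ule _; apply: ler_wpM2l; first exact: scale_ge0.
  by apply: d21; rewrite sqrtr_ge0.
apply: le_trans (ltW uq) _; rewrite mulrC; apply: ler_wpM2l => //; exact: scale_ge0.
Qed.

End probability.

End coverage.

Theorem theorem6 (R : realType) (n p s : nat)
  (X : 'M[R]_(n, p)) (a : 'cV[R]_p) (C : 'M[R]_(p, s)) (t : 'cV[R]_s)
  (d1 d2 : R -> R) :
  (p < n)%N -> \rank X = p ->
  a != 0 ->
  (0 < s)%N -> (s < p)%N -> \rank C = s ->
  ~~ (a^T <= C^T)%MS ->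
  (forall x, 0 <= x -> 0 < d1 x) -> (forall x, 0 <= x -> 0 < d2 x) ->
  measurable_fun (`[0, +oo[ : set R) d1 -> measurable_fun (`[0, +oo[ : set R) d2 ->
  (forall x, 0 <= x -> d2 x <= d1 x) ->
  (exists (eps0 lo hi : R), 0 < eps0 /\ 0 <= lo /\ lo < hi /\
     forall x, lo <= x <= hi -> d2 x + eps0 < d1 x) ->
  forall (beta : 'cV[R]_p) (sigma : R), 0 < sigma ->
  forall (dT : measure_display) (T : measurableType dT) (P : probability T R)
         (eps : 'I_n -> {RV P >-> R}),
  mutually_independent P (fun i => eps i : T -> R) ->
  (forall i (A : set R), measurable A ->
     distribution P (eps i) A = normal_prob 0 sigma A) ->
  let Y := fun w : T => X *m beta + \col_i eps i w in
  let theta := sc (a^T *m beta) in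
  let tau := C^T *m beta - t in
  (forall j : 'I_s,
     ('E_P[fun w => ((tauhat X C t (Y w) - tau) j ord0 * (thetahat X a (Y w) - theta))%R]
      = 0)%E) ->
  (P [set w | inJ X a C t d2 theta (Y w)] < P [set w | inJ X a C t d1 theta (Y w)])%E.
Proof.
move=> pn rX a0 s0 _ rC aC _ d20 md1 md2 d21 [eps0 [lo [hi [e0 [lo0 [lohi gap]]]]]].
move=> beta sigma sigma0 dT T P eps indep law Y theta tau _.
exact: (coverage_lt X a C t beta pn rX a0 s0 rC aC (lt0r_neq0 sigma0) indep law
  d1 d2 eps0 lo hi).
Qed.
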